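(* Let $0<a<b<\infty$, let $f,g$ be continuous real functions on $[a,b]$ with $g(t)>0$ for $t\in[a,b]$, and define on $(0,\infty)$ $$F(x)=\int_a^b f(t)e^{-xt}\,dt,\qquad G(x)=\int_a^b g(t)e^{-xt}\,dt .$$ Put $H_{F,G}(0^+)=\lim_{x\to0^+}\left(\frac{F'(x)}{G'(x)}G(x)-F(x)\right)$. (A) Suppose there is $t^*\in(a,b)$ such that $f/g$ is strictly increasing on $[a,t^*]$ and strictly decreasing on $[t^*,b]$. Then $x\mapsto F(x)/G(x)$ is decreasing on $(0,\infty)$ if and only if $H_{F,G}(0^+)\ge 0$, with $$\lim_{x\to0^+}\frac{F(x)}{G(x)}=\frac{\int_a^b f(t)\,dt}{\int_a^b g(t)\,dt},\qquad \lim_{x\to\infty}\frac{F(x)}{G(x)}=\frac{f(a)}{g(a)}.$$ If $H_{F,G}(0^+)<0$, then there is at least one $x^*>0$ such that $F/G$ is increasing on $(0,x^* )$ and decreasing on $(x^*,\infty)$. (B) Suppose instead there is $t^*\in(a,b)$ such that $f/g$ is strictly decreasing on $[a,t^*]$ and strictly increasing on $[t^*,b]$. Then $x\mapsto F(x)/G(x)$ is increasing on $(0,\infty)$ if and only if $H_{F,G}(0^+)\le 0$, with the same two limits $$\lim_{x\to0^+}\frac{F(x)}{G(x)}=\frac{\int_a^b f(t)\,dt}{\int_a^b g(t)\,dt},\qquad \lim_{x\to\infty}\frac{F(x)}{G(x)}=\frac{f(a)}{g(a)}.$$ If $H_{F,G}(0^+)>0$, then there is at least one $x^*>0$ such that $F/G$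 is decreasing on $(0,x^* )$ and increasing on $(x^*,\infty)$.
   Context: ''Increasing'' and ''decreasing'' without the word ''strictly'' are meant in the weak sense. *)

(* Defs.v *)
From Stdlib Require Import Reals.
From Coquelicot Require Import Coquelicot.

Open Scope R_scope.

Definition increasing_on (D : R -> Prop) (h : R -> R) : Prop :=
  forall x y, D x -> D y -> x <= y -> h x <= h y.

Definition decreasing_on (D : R -> Prop) (h : R -> R) : Prop :=
  forall x y, D x -> D y -> x <= y -> h y <= h x.

Definition strictly_increasing_on (D : R -> Prop) (h : R -> R) : Prop :=
  forall x y, D x -> D y -> x < y -> h x < h y.

Definition strictly_decreasing_on (D : R -> Prop) (h : R -> R) : Prop :=
  forall x y, D x -> D y -> x < y -> h y < h x.

(* [f] matters only on [a, b], and the transform is used only at [x > 0]. *)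
Definition laplace (a b : R) (f : R -> R) (x : R) : R :=
  RInt (fun t => f t * exp (- (x * t))) a b.

Definition Haux (F G : R -> R) (x : R) : R :=
  Derive F x / Derive G x * G x - F x.

(* Main.v *)
(* Let [Q = F / G], and let [c = Q x0].  In case (A), [f - c g] has sign pattern -, +, - (possibly
   lacking an outer block) with sign changes [t1 < t2].  Comparing [exp (- (y t))] with its chord
   through [t1] and [t2] gives [F (x0 + y) < c G (x0 + y)], that is [Q (x0 + y) < Q x0], as soon as
   [y <> 0] and [y Q'(x0) <= 0].  Hence the set where [Q' <= 0] is closed upwards, and [Q]
   decreases on it and increases on its complement.  All this holds on the whole real line, so the
   sign of [Q'] at [0], which is opposite to that of [H], decides whether the increasing part meets
   the positive half-line.  The decreasing part is nonempty since [Q] tends to [f a / g a] while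
   being eventually above it.  Case (B) is case (A) for [- f]. *)
Require Import Defs.
From Stdlib Require Import Reals Lra FunctionalExtensionality.
From Coquelicot Require Import Coquelicot.

Open Scope R_scope.

(** * Integrals of continuous functions *)

Lemma continuity_continuous (k : R -> R) (t : R) : continuity k -> continuous k t.
Proof. intros hk; apply continuity_pt_filterlim, hk. Qed.

Lemma ex_RInt_continuity (k : R -> R) (p q : R) : continuity k -> ex_RInt k p q.
Proof.
intros hk; apply (ex_RInt_continuous (V := R_CompleteNormedModule)).
intros; now apply continuity_continuous.
Qed.

Lemma RInt_lin (u v : R -> R) (al be p q : R) :
  continuity u -> continuity v ->
  RInt (fun t => al * u t + be * v t) p q = al * RInt u p q + be * RInt v p q.
Proof.
intros hu hv; apply is_RInt_unique.
apply (is_RInt_plus (V := R_NormedModule));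
  apply (is_RInt_scal (V := R_NormedModule)), (RInt_correct (V := R_CompleteNormedModule));
  now apply ex_RInt_continuity.
Qed.

(** Strictness is asked only on a subinterval because the integrands below may vanish elsewhere, for
    instance where a chord meets its curve. *)
Lemma RInt_pos (k : R -> R) (a b c d : R) :
  continuity k -> a <= c -> c < d -> d <= b ->
  (forall t, a < t < b -> 0 <= k t) -> (forall t, c < t < d -> 0 < k t) ->
  0 < RInt k a b.
Proof.
intros hk hac hcd hdb h0 hpos.
rewrite <- (RInt_Chasles k a c b), <- (RInt_Chasles k c d b)
  by now apply ex_RInt_continuity.
unfold plus; simpl.
assert (0 <= RInt k a c).
{ apply RInt_ge_0; auto using ex_RInt_continuity; intros; apply h0; lra. }
assert (0 <= RInt k d b).
{ apply RInt_ge_0; auto using ex_RInt_continuity; intros; apply h0; lra. }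
assert (0 < RInt k c d).
{ apply RInt_gt_0; auto; intros; now apply continuity_continuous. }
lra.
Qed.

Lemma RInt_ext_le (u v : R -> R) (p q : R) :
  p <= q -> (forall t, p <= t <= q -> u t = v t) -> RInt u p q = RInt v p q.
Proof.
intros hpq huv; apply RInt_ext; intros t; rewrite Rmin_left, Rmax_right by lra.
intros; apply huv; lra.
Qed.

(** * Convexity of the exponential and functions with two sign changes *)

(** The tangent at [t] lies strictly below the curve at [s] and [u]; weighting these two
    inequalities by [u - t] and [t - s] cancels the slope terms. *)
Lemma exp_neg_strictly_convex (y s t u : R) :
  y <> 0 -> s < t < u ->
  exp (- (y * t)) * (u - s) < exp (- (y * s)) * (u - t) + exp (- (y * u)) * (t - s).
Proof.
intros hy hst.
assert (tangent : forall v, v <> t ->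
  exp (- (y * t)) * (1 - y * (v - t)) < exp (- (y * v))).
{ intros v hv.
  replace (- (y * v)) with (- (y * t) + - y * (v - t)) by ring.
  rewrite exp_plus; apply Rmult_lt_compat_l; [apply exp_pos|].
  replace (1 - y * (v - t)) with (1 + - y * (v - t)) by ring.
  apply exp_ineq1; intros h; apply Rmult_integral in h; lra. }
assert (hs := Rmult_lt_compat_r (u - t) _ _ ltac:(lra) (tangent s ltac:(lra))).
assert (hu := Rmult_lt_compat_r (t - s) _ _ ltac:(lra) (tangent u ltac:(lra))).
lra.
Qed.

Lemma continuity_exp_lin (y : R) : continuity (fun t => exp (- (y * t))).
Proof. reg. Qed.

(* Replace the exponential by its chord through [t1] and [t2]: the difference has the sign of [k],
   and the chord is integrated by the two moment hypotheses. *)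
Lemma RInt_exp_two_sign_changes (a b t1 t2 y : R) (k : R -> R) :
  continuity k -> a <= t1 -> t1 < t2 -> t2 <= b ->
  (forall t, a < t <= t1 -> k t <= 0) ->
  (forall t, t1 < t < t2 -> 0 < k t) ->
  (forall t, t2 <= t < b -> k t <= 0) ->
  RInt k a b = 0 -> y <> 0 -> 0 <= y * RInt (fun t => t * k t) a b ->
  RInt (fun t => k t * exp (- (y * t))) a b < 0.
Proof.
intros hk h1 h12 h2 k1 k12 k2 I0 hy I1.
set (E := fun t => exp (- (y * t))).
(* The chord of [E] through [t1] and [t2] is [(A + B * t) / (t2 - t1)]. *)
set (A := E t1 * t2 - E t2 * t1); set (B := E t2 - E t1).
set (m := fun t => t * k t).
assert (cE : continuity E) by apply continuity_exp_lin.
assert (cm : continuity m) by (unfold m; reg).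
assert (ckE : continuity (fun t => k t * E t)) by reg.
assert (cAB : continuity (fun t => A * k t + B * m t)) by reg.
(* The integrand is [t2 - t1] times [k t] times (chord minus [E t]), arranged in the shape expected
   by [RInt_lin]. *)
assert (pos : 0 < RInt (fun t => 1 * (A * k t + B * m t) + - (t2 - t1) * (k t * E t)) a b).
{ apply (RInt_pos _ a b t1 t2); try lra.
  - reg.
  - intros t ht.
    replace (1 * (A * k t + B * m t) + - (t2 - t1) * (k t * E t))
      with (k t * (E t1 * (t2 - t) + E t2 * (t - t1) - E t * (t2 - t1)))
      by (unfold A, B, m; ring).
    destruct (Rlt_le_dec t t1) as [l1|l1].
    { assert (hc := exp_neg_strictly_convex y t t1 t2 hy ltac:(lra)).
      assert (k t <= 0) by (apply k1; lra). unfold E in *; nra. }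
    destruct (Rlt_le_dec t2 t) as [l2|l2].
    { assert (hc := exp_neg_strictly_convex y t1 t2 t hy ltac:(lra)).
      assert (k t <= 0) by (apply k2; lra). unfold E in *; nra. }
    destruct (Req_dec t t1) as [->|n1]; [right; ring|].
    destruct (Req_dec t t2) as [->|n2]; [right; ring|].
    assert (hc := exp_neg_strictly_convex y t1 t t2 hy ltac:(lra)).
    assert (0 < k t) by (apply k12; lra). unfold E in *; nra.
  - intros t ht.
    replace (1 * (A * k t + B * m t) + - (t2 - t1) * (k t * E t))
      with (k t * (E t1 * (t2 - t) + E t2 * (t - t1) - E t * (t2 - t1)))
      by (unfold A, B, m; ring).
    assert (hc := exp_neg_strictly_convex y t1 t t2 hy ltac:(lra)).
    assert (0 < k t) by (apply k12; lra). unfold E in *; nra. }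
rewrite !RInt_lin, I0 in pos by assumption.
(* Only [B] times the first moment survives from the chord. Since [E] is monotone, [B] has the sign
   opposite to [y], while the moment weakly has the sign of [y]. *)
assert (BI : B * RInt m a b <= 0).
{ destruct (Rlt_le_dec 0 y) as [py|ny].
  - assert (B < 0).
    { unfold B, E; apply Rlt_minus, exp_increasing; nra. }
    assert (0 <= RInt m a b) by (fold m in I1; nra). nra.
  - assert (0 < B).
    { unfold B, E; apply Rlt_0_minus, exp_increasing; nra. }
    assert (RInt m a b <= 0) by (fold m in I1; nra). nra. }
change (RInt (fun t => k t * exp (- (y * t))) a b)
  with (RInt (fun t => k t * E t) a b).
nra.
Qed.

(** * Sign of the transform for large parameters *)

(** After multiplication by [exp (x * c)] the weight is at most 1 beyond [c], so the loss there is
    bounded by [M], while the gain on [[a, m]] is at least [I * exp (x * (c - m))], which is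
    unbounded in [x]. *)
Lemma exp_RInt_eventually_pos (k : R -> R) (a b c : R) :
  continuity k -> a < c -> c <= b -> (forall t, a < t < c -> 0 < k t) ->
  exists X, forall x, X < x -> 0 < RInt (fun t => k t * exp (- (x * t))) a b.
Proof.
intros hk hac hcb hpos.
set (m := (a + c) / 2).
set (I := RInt k a m).
set (M := RInt (fun t => Rabs (k t)) c b).
assert (cabs : continuity (fun t => Rabs (k t)))
  by (apply (continuity_comp k Rabs); auto using Rcontinuity_abs).
assert (I0 : 0 < I).
{ apply (RInt_pos _ a m a m); unfold m; try lra; auto; intros; try apply Rlt_le; apply hpos; lra. }
assert (M0 : 0 <= M).
{ apply RInt_ge_0; auto using ex_RInt_continuity; intros; apply Rabs_pos. }
(* Beyond this threshold [I * (x * (c - m))] exceeds [M], and [1 + z < exp z] suffices to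
   conclude. *)
exists (M / (I * (c - m))); intros x hx.
assert (hm : 0 < c - m) by (unfold m; lra).
assert (hIm : 0 < I * (c - m)) by nra.
assert (x0 : 0 < x).
{ apply Rle_lt_trans with (2 := hx). apply Rdiv_le_0_compat; lra. }
assert (hM : M < x * (c - m) * I).
{ apply Rlt_div_l in hx; [lra|exact hIm]. }
set (E := fun t => exp (x * (c - t))).
assert (cE : continuity E) by (unfold E; reg).
assert (ckE : continuity (fun t => k t * E t)) by reg.
(* The zero term only serves to match [RInt_lin]. *)
replace (RInt _ a b) with (exp (- (x * c)) * RInt (fun t => k t * E t) a b + 0 * RInt k a b).
2:{ rewrite <- RInt_lin by assumption; apply RInt_ext; intros t _; unfold E; simpl.
    replace (- (x * t)) with (- (x * c) + x * (c - t)) by ring.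
    rewrite exp_plus; ring. }
rewrite Rmult_0_l, Rplus_0_r; apply Rmult_lt_0_compat; [apply exp_pos|].
rewrite <- (RInt_Chasles _ a m b), <- (RInt_Chasles _ m c b) by now apply ex_RInt_continuity.
unfold plus; simpl.
assert (h1 : exp (x * (c - m)) * I <= RInt (fun t => k t * E t) a m).
{ replace (_ * I) with (exp (x * (c - m)) * I + 0 * RInt k a m) by ring.
  unfold I; rewrite <- RInt_lin by assumption.
  apply RInt_le; [unfold m; lra| apply ex_RInt_continuity; reg | now apply ex_RInt_continuity|].
  intros t ht. assert (0 < k t) by (apply hpos; lra).
  assert (exp (x * (c - m)) < E t) by (apply exp_increasing; nra). nra. }
assert (h2 : 0 <= RInt (fun t => k t * E t) m c).
{ apply RInt_ge_0; [lra|now apply ex_RInt_continuity|].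
  intros t ht. assert (0 < k t) by (apply hpos; unfold m in ht; lra).
  apply Rmult_le_pos; [lra|apply Rlt_le, exp_pos]. }
assert (h3 : - M <= RInt (fun t => k t * E t) c b).
{ replace (- M) with (-1 * M + 0 * M) by ring.
  unfold M; rewrite <- RInt_lin by assumption.
  apply RInt_le; [lra|apply ex_RInt_continuity; reg | now apply ex_RInt_continuity|].
  intros t ht.
  assert (E t <= 1).
  { rewrite <- exp_0; apply Rlt_le, exp_increasing; nra. }
  assert (0 < E t) by apply exp_pos.
  assert (hk' := Rle_abs (- k t)); rewrite Rabs_Ropp in hk'.
  assert (0 <= Rabs (k t)) by apply Rabs_pos. nra. }
assert (h4 := exp_ineq1 (x * (c - m)) ltac:(nra)).
assert (h5 := Rmult_lt_compat_r I _ _ I0 h4).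
lra.
Qed.

(** * Differentiability, linearity and positivity of the transform *)

Lemma continuity_2d_pt_laplace_kernel (k : R -> R) (x t : R) :
  continuity k -> continuity_2d_pt (fun u v => k v * exp (- (u * v))) x t.
Proof.
intros hk; apply continuity_2d_pt_mult.
- apply (continuity_1d_2d_pt_comp k); [apply hk|apply continuity_2d_pt_id2].
- apply (continuity_1d_2d_pt_comp exp); [apply derivable_continuous, derivable_exp|].
  apply continuity_2d_pt_opp, continuity_2d_pt_mult;
    [apply continuity_2d_pt_id1|apply continuity_2d_pt_id2].
Qed.

(** Differentiation under the integral sign, by joint continuity of the differentiated kernel. The
    derivative is again a transform, and [x] ranges over the whole line. *)
Lemma is_derive_laplace (a b : R) (f : R -> R) (x : R) :
  continuity f -> is_derive (laplace a b f) x (laplace a b (fun t => - (t * f t)) x).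
Proof.
intros hf.
assert (d : forall t u,
  is_derive (fun z => f t * exp (- (z * t))) u (- (t * f t) * exp (- (u * t)))).
{ intros t u; auto_derive; [exact I|ring]. }
assert (D : forall t u,
  Derive (fun z => f t * exp (- (z * t))) u = - (t * f t) * exp (- (u * t))).
{ intros; apply is_derive_unique, d. }
unfold laplace at 2.
rewrite <- (RInt_ext (fun t => Derive (fun z => f t * exp (- (z * t))) x)) by (intros; apply D).
apply (is_derive_RInt_param (fun x t => f t * exp (- (x * t)))).
- apply filter_forall; intros u t _; eexists; apply d.
- intros t _; apply continuity_2d_pt_ext with (f := fun u v => - (v * f v) * exp (- (u * v))).
  + intros u v; now rewrite D.
  + apply (continuity_2d_pt_laplace_kernel (fun v => - (v * f v))); reg.
- apply filter_forall; intros u; apply ex_RInt_continuity; reg.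
Qed.

Lemma continuous_laplace (a b : R) (f : R -> R) (x : R) :
  continuity f -> continuous (laplace a b f) x.
Proof.
intros hf; apply (ex_derive_continuous (K := R_AbsRing) (V := R_NormedModule)).
eexists; now apply is_derive_laplace.
Qed.

Lemma laplace_lin (a b : R) (f g : R -> R) (al be x : R) :
  continuity f -> continuity g ->
  laplace a b (fun t => al * f t + be * g t) x = al * laplace a b f x + be * laplace a b g x.
Proof.
intros hf hg; unfold laplace.
rewrite <- RInt_lin by reg.
apply RInt_ext; intros; simpl; ring.
Qed.

Lemma laplace_pos (a b : R) (g : R -> R) (x : R) :
  a < b -> continuity g -> (forall t, a < t < b -> 0 < g t) -> 0 < laplace a b g x.
Proof.
intros hab hg hpos; unfold laplace; apply (RInt_pos _ a b a b); try lra; [reg| |];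
  intros; try apply Rlt_le; apply Rmult_lt_0_compat; auto using exp_pos.
Qed.

Lemma laplace_ext (a b : R) (f g : R -> R) (x : R) :
  a <= b -> (forall t, a <= t <= b -> f t = g t) -> laplace a b f x = laplace a b g x.
Proof. intros hab h; apply RInt_ext_le; auto; intros; now rewrite h. Qed.

(** * Level crossings of a unimodal ratio and the resulting comparison of transforms *)

(** [f - c * g] has the sign of [f / g - c], so once nonnegative it is positive at every later point
    up to [ts]. The crossing [t1] comes from the intermediate value theorem. *)
Lemma superlevel_increasing (f g : R -> R) (a ts c : R) :
  continuity f -> continuity g -> a < ts ->
  (forall t, a <= t <= ts -> 0 < g t) ->
  strictly_increasing_on (fun t => a <= t <= ts) (fun t => f t / g t) ->
  c < f ts / g ts ->
  exists t1, a <= t1 < ts /\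
    (forall t, a < t <= t1 -> f t - c * g t <= 0) /\
    (forall t, t1 < t <= ts -> 0 < f t - c * g t).
Proof.
intros hf hg hts hpos hr hc.
set (k := fun t => f t - c * g t).
assert (ck : continuity k) by (unfold k; reg).
assert (fr : forall t, a <= t <= ts -> k t = (f t / g t - c) * g t).
{ intros t ht; unfold k; assert (0 < g t) by auto; field; lra. }
assert (up : forall s t, a <= s -> s < t -> t <= ts -> 0 <= k s -> 0 < k t).
{ intros s t h1 h2 h3 h0.
  assert (gs := hpos s ltac:(lra)); assert (gt := hpos t ltac:(lra)).
  rewrite fr in h0 by lra; rewrite fr by lra.
  assert (f s / g s < f t / g t) by (apply hr; lra).
  apply Rmult_lt_0_compat; nra. }
assert (kts : 0 < k ts).
{ rewrite fr by lra; apply Rmult_lt_0_compat; [lra|apply hpos; lra]. }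
destruct (Rle_lt_dec 0 (k a)) as [ka|ka].
(* There is no negative block: [t1 = a] makes the range [a < t <= t1] empty. *)
- exists a; split; [lra|split; intros t ht; [lra|]].
  apply (up a); lra.
- destruct (IVT_gen k a ts 0 ck) as [t1 [h1 k1]].
  { rewrite Rmin_left, Rmax_right; lra. }
  rewrite Rmin_left, Rmax_right in h1 by lra.
  assert (t1 <> ts) by (intros ->; lra).
  exists t1; split; [lra|split; intros t ht].
  + apply Rnot_lt_le; intros kt; fold (k t) in kt.
    destruct (Req_dec t t1) as [->|ne]; [lra|].
    assert (0 < k t1) by (apply (up t); lra). lra.
  + apply (up t1); unfold k in *; lra.
Qed.

(** Mirror image of [superlevel_increasing] under [t -> - t]. *)
Lemma superlevel_decreasing (f g : R -> R) (ts b c : R) :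
  continuity f -> continuity g -> ts < b ->
  (forall t, ts <= t <= b -> 0 < g t) ->
  strictly_decreasing_on (fun t => ts <= t <= b) (fun t => f t / g t) ->
  c < f ts / g ts ->
  exists t2, ts < t2 <= b /\
    (forall t, t2 <= t < b -> f t - c * g t <= 0) /\
    (forall t, ts <= t < t2 -> 0 < f t - c * g t).
Proof.
intros hf hg hts hpos hr hc.
destruct (superlevel_increasing (fun t => f (- t)) (fun t => g (- t)) (- b) (- ts) c)
  as [t1 [h1 [h2 h3]]]; try lra.
- apply (continuity_comp (fun t => - t) f); [reg|exact hf].
- apply (continuity_comp (fun t => - t) g); [reg|exact hg].
- intros t ht; apply hpos; lra.
- intros s t hs ht hst; apply hr; lra.
- now rewrite Ropp_involutive.
- exists (- t1); split; [lra|split; intros t ht].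
  + specialize (h2 (- t) ltac:(lra)); now rewrite Ropp_involutive in h2.
  + specialize (h3 (- t) ltac:(lra)); now rewrite Ropp_involutive in h3.
Qed.

(* The numerator of the derivative of [laplace a b f / laplace a b g]. *)
Definition deriv_num (a b : R) (f g : R -> R) (x : R) : R :=
  laplace a b (fun t => - (t * f t)) x * laplace a b g x -
  laplace a b f x * laplace a b (fun t => - (t * g t)) x.

(** [RInt_exp_two_sign_changes] is applied to [f - c * g] weighted by [exp (- (x * t))], where [c]
    is the ratio at [x]: this choice makes the integral vanish. *)
Lemma laplace_ratio_peak (a b ts : R) (f g : R -> R) (x y : R) :
  continuity f -> continuity g -> a < ts < b ->
  (forall t, a <= t <= b -> 0 < g t) ->
  strictly_increasing_on (fun t => a <= t <= ts) (fun t => f t / g t) ->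
  strictly_decreasing_on (fun t => ts <= t <= b) (fun t => f t / g t) ->
  y <> 0 -> y * deriv_num a b f g x <= 0 ->
  laplace a b f (x + y) / laplace a b g (x + y) < laplace a b f x / laplace a b g x.
Proof.
intros hf hg hts hpos hi hd hy hD.
assert (Gpos : forall z, 0 < laplace a b g z).
{ intros z; apply laplace_pos; [lra|exact hg|]; intros; apply hpos; lra. }
set (c := laplace a b f x / laplace a b g x).
assert (Fx : laplace a b f x = c * laplace a b g x).
{ unfold c; field; specialize (Gpos x); lra. }
(* [c] is the mean of [f / g] for the weight [g t * exp (- (x * t))], hence strictly below the
   maximum, attained at [ts]. *)
assert (hc : c < f ts / g ts).
{ set (M := f ts / g ts).
  assert (pos : 0 < laplace a b (fun t => -1 * f t + M * g t) x).
  { apply (RInt_pos _ a b a ts); try lra; [reg| |].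
    - intros t ht; apply Rmult_le_pos; [|apply Rlt_le, exp_pos].
      assert (gt := hpos t ltac:(lra)).
      replace (-1 * f t + M * g t) with ((M - f t / g t) * g t) by (field; lra).
      apply Rmult_le_pos; [|lra].
      destruct (Rtotal_order t ts) as [l|[->|l]]; [|unfold M; lra|].
      + assert (f t / g t < M) by (apply hi; lra). lra.
      + assert (f t / g t < M) by (apply hd; lra). lra.
    - intros t ht; apply Rmult_lt_0_compat; [|apply exp_pos].
      assert (gt := hpos t ltac:(lra)).
      replace (-1 * f t + M * g t) with ((M - f t / g t) * g t) by (field; lra).
      assert (f t / g t < M) by (apply hi; lra).
      apply Rmult_lt_0_compat; lra. }
  rewrite laplace_lin, Fx in pos by assumption.
  specialize (Gpos x); nra. }
destruct (superlevel_increasing f g a ts c) as [t1 [h1 [k1 k1']]]; auto; try lra.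
{ intros; apply hpos; lra. }
destruct (superlevel_decreasing f g ts b c) as [t2 [h2 [k2 k2']]]; auto; try lra.
{ intros; apply hpos; lra. }
set (k := fun t => (1 * f t + - c * g t) * exp (- (x * t))).
assert (kpos : forall t, 0 < f t - c * g t -> 0 < k t).
{ intros t ht; unfold k; apply Rmult_lt_0_compat; [lra|apply exp_pos]. }
assert (kneg : forall t, f t - c * g t <= 0 -> k t <= 0).
{ intros t ht; unfold k; assert (0 < exp (- (x * t))) by apply exp_pos; nra. }
assert (I0 : RInt k a b = 0).
{ change (laplace a b (fun t => 1 * f t + - c * g t) x = 0).
  rewrite laplace_lin by assumption; lra. }
(* As [F = c G] at [x], the numerator [F' G - F G'] is [G (F' - c G')], and each derivative brings a
   factor [- t]. The hypothesis on [y] thus becomes the moment condition. *)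
assert (I1 : RInt (fun t => t * k t) a b * laplace a b g x = - deriv_num a b f g x).
{ transitivity (laplace a b (fun t => -1 * - (t * f t) + c * - (t * g t)) x * laplace a b g x).
  - f_equal; apply RInt_ext; intros; unfold k; simpl; ring.
  - rewrite laplace_lin by reg; unfold deriv_num; rewrite Fx; ring. }
assert (lt0 : laplace a b (fun t => 1 * f t + - c * g t) (x + y) < 0).
{ replace (laplace _ _ _ _) with (RInt (fun t => k t * exp (- (y * t))) a b).
  2:{ apply RInt_ext; intros t _; unfold k; simpl.
      replace (- ((x + y) * t)) with (- (x * t) + - (y * t)) by ring.
      rewrite exp_plus; ring. }
  apply (RInt_exp_two_sign_changes a b t1 t2); try lra; try assumption.
  - unfold k; reg.
  - intros t ht. apply kneg, k1; lra.
  - intros t ht. apply kpos.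
    destruct (Rle_lt_dec t ts); [apply k1'|apply k2']; lra.
  - intros t ht; apply kneg, k2; lra.
  - specialize (Gpos x). nra. }
rewrite laplace_lin in lt0 by assumption.
apply Rlt_div_l; [apply Gpos|lra].
Qed.

(** * Limits of the ratio at infinity and at zero *)

(** Leaving [t = a] out of the last hypothesis admits [l = f a / g a], which shows that the ratio is
    eventually above its limit. *)
Lemma laplace_ratio_eventually_gt (a b c l : R) (f g : R -> R) :
  continuity f -> continuity g -> a < c <= b ->
  (forall t, a < t < b -> 0 < g t) -> (forall t, a < t < c -> l * g t < f t) ->
  exists X, forall x, X < x -> l < laplace a b f x / laplace a b g x.
Proof.
intros hf hg hc hpos hl.
destruct (exp_RInt_eventually_pos (fun t => 1 * f t + - l * g t) a b c) as [X hX]; try lra.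
- reg.
- intros t ht; specialize (hl t ht); lra.
- exists X; intros x hx; specialize (hX x hx).
  change (0 < laplace a b (fun t => 1 * f t + - l * g t) x) in hX.
  rewrite laplace_lin in hX by assumption.
  apply Rlt_div_r; [apply laplace_pos; auto; lra|lra].
Qed.

(** Continuity at [a] keeps [f - l * g] positive on a short interval to the right of [a]. *)
Lemma laplace_ratio_eventually_gt_endpoint (a b l : R) (f g : R -> R) :
  continuity f -> continuity g -> a < b ->
  (forall t, a <= t <= b -> 0 < g t) -> l < f a / g a ->
  exists X, forall x, X < x -> l < laplace a b f x / laplace a b g x.
Proof.
intros hf hg hab hpos hl.
assert (ga := hpos a ltac:(lra)).
assert (k0 : 0 < f a - l * g a).
{ apply Rlt_div_r in hl; lra. }
assert (ck : continuity (fun t => f t - l * g t)) by reg.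
destruct (proj1 (filterlim_locally _ _) (continuity_continuous _ a ck) (mkposreal _ k0))
  as [d hd].
apply (laplace_ratio_eventually_gt a b (Rmin b (a + d))); auto.
- destruct d as [d pd]; simpl; split; [apply Rmin_glb_lt; lra|apply Rmin_l].
- intros; apply hpos; lra.
- intros t ht.
  assert (Rmin b (a + d) <= a + d) by apply Rmin_r.
  specialize (hd t); unfold ball in hd; simpl in hd.
  unfold AbsRing_ball, abs, minus, plus, opp in hd; simpl in hd.
  rewrite (Rabs_pos_eq (t + - a)) in hd by lra.
  specialize (hd ltac:(lra)); apply Rabs_lt_between in hd; lra.
Qed.

Lemma laplace_opp (a b : R) (f : R -> R) (x : R) :
  continuity f -> laplace a b (fun t => - f t) x = - laplace a b f x.
Proof.
intros hf; transitivity (laplace a b (fun t => -1 * f t + 0 * f t) x).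
- apply RInt_ext; intros; simpl; ring.
- rewrite laplace_lin by assumption; ring.
Qed.

(** The upper estimate is the lower estimate for [- f]. *)
Lemma is_lim_laplace_ratio (a b : R) (f g : R -> R) :
  continuity f -> continuity g -> a < b ->
  (forall t, a <= t <= b -> 0 < g t) ->
  is_lim (fun x => laplace a b f x / laplace a b g x) p_infty (f a / g a).
Proof.
intros hf hg hab hpos; apply is_lim_spec; intros [e he]; simpl.
destruct (laplace_ratio_eventually_gt_endpoint a b (f a / g a - e) f g) as [X hX]; auto; try lra.
destruct (laplace_ratio_eventually_gt_endpoint a b (- (f a / g a) - e) (fun t => - f t) g)
  as [Y hY]; auto; try lra.
{ reg. }
exists (Rmax X Y); intros x hx.
specialize (hX x (Rle_lt_trans _ _ _ (Rmax_l X Y) hx)).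
specialize (hY x (Rle_lt_trans _ _ _ (Rmax_r X Y) hx)).
rewrite laplace_opp in hY by assumption.
rewrite Rdiv_opp_l in hY.
apply Rabs_lt_between; lra.
Qed.

Lemma continuous_div (u v : R -> R) (x : R) :
  continuous u x -> continuous v x -> v x <> 0 -> continuous (fun t => u t / v t) x.
Proof.
intros hu hv h0; apply (continuous_mult (K := R_AbsRing) u (fun t => / v t)); [exact hu|].
now apply (continuous_comp v Rinv), continuous_Rinv.
Qed.

Lemma filterlim_at_right_continuous (u : R -> R) (x : R) :
  continuous u x -> filterlim u (at_right x) (locally (u x)).
Proof. exact (filterlim_filter_le_1 u (filter_le_within _)). Qed.

Lemma laplace_0 (a b : R) (f : R -> R) : laplace a b f 0 = RInt f a b.
Proof.
apply RInt_ext; intros; simpl; rewrite Rmult_0_l, Ropp_0, exp_0; ring.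
Qed.

(** The ratio is continuous at 0, where the transforms are the plain integrals. *)
Lemma laplace_ratio_lim_0 (a b : R) (f g : R -> R) :
  continuity f -> continuity g -> a < b -> (forall t, a <= t <= b -> 0 < g t) ->
  filterlim (fun x => laplace a b f x / laplace a b g x) (at_right 0)
    (locally (RInt f a b / RInt g a b)).
Proof.
intros hf hg hab hpos; rewrite <- !laplace_0.
apply (filterlim_at_right_continuous (fun x => laplace a b f x / laplace a b g x)).
apply continuous_div; try now apply continuous_laplace.
apply Rgt_not_eq, laplace_pos; auto; intros; apply hpos; lra.
Qed.

Lemma laplace_mult_id_neg (a b : R) (g : R -> R) (x : R) :
  0 < a -> a < b -> continuity g -> (forall t, a <= t <= b -> 0 < g t) ->
  laplace a b (fun t => - (t * g t)) x < 0.
Proof.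
intros ha hab hg hpos; rewrite (laplace_opp a b (fun t => t * g t)) by reg.
apply Ropp_lt_gt_0_contravar, laplace_pos; [lra|reg|].
intros t ht; apply Rmult_lt_0_compat; [lra|apply hpos; lra].
Qed.

(** * The auxiliary function and its limit at zero *)

(** The denominator is [G'], which is negative, so [Haux] has the sign opposite to that of the
    derivative of the ratio. *)
Lemma Haux_laplace (a b : R) (f g : R -> R) (x : R) :
  0 < a -> a < b -> continuity f -> continuity g -> (forall t, a <= t <= b -> 0 < g t) ->
  Haux (laplace a b f) (laplace a b g) x =
  deriv_num a b f g x / laplace a b (fun t => - (t * g t)) x.
Proof.
intros ha hab hf hg hpos; unfold Haux, deriv_num.
rewrite (is_derive_unique _ _ _ (is_derive_laplace a b f x hf)).
rewrite (is_derive_unique _ _ _ (is_derive_laplace a b g x hg)).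
field; apply Rlt_not_eq, laplace_mult_id_neg; auto.
Qed.

Lemma filterlim_Haux (a b : R) (f g : R -> R) :
  0 < a -> a < b -> continuity f -> continuity g -> (forall t, a <= t <= b -> 0 < g t) ->
  filterlim (Haux (laplace a b f) (laplace a b g)) (at_right 0)
    (locally (Haux (laplace a b f) (laplace a b g) 0)).
Proof.
intros ha hab hf hg hpos; rewrite Haux_laplace by assumption.
apply (filterlim_ext (fun x => deriv_num a b f g x / laplace a b (fun t => - (t * g t)) x)).
{ intros x; now rewrite Haux_laplace. }
apply (filterlim_at_right_continuous
  (fun x => deriv_num a b f g x / laplace a b (fun t => - (t * g t)) x)).
apply continuous_div.
- unfold deriv_num.
  apply (continuous_minus (V := R_NormedModule)); apply (continuous_mult (K := R_AbsRing));
    apply continuous_laplace; reg.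
- apply continuous_laplace; reg.
- apply Rlt_not_eq, laplace_mult_id_neg; auto.
Qed.

(** * Monotonicity of the ratio in case (A) *)

Lemma laplace_ratio_unimodal (a b ts : R) (f g : R -> R) :
  let F := laplace a b f in
  let G := laplace a b g in
  let Q := fun x => F x / G x in
  0 < a -> continuity f -> continuity g -> a < ts < b ->
  (forall t, a <= t <= b -> 0 < g t) ->
  strictly_increasing_on (fun t => a <= t <= ts) (fun t => f t / g t) ->
  strictly_decreasing_on (fun t => ts <= t <= b) (fun t => f t / g t) ->
  (decreasing_on (fun x => 0 < x) Q <-> 0 <= Haux F G 0) /\
  (Haux F G 0 < 0 ->
    exists xs, 0 < xs /\
      increasing_on (fun x => 0 < x < xs) Q /\ decreasing_on (fun x => xs < x) Q).
Proof.
intros F G Q ha hf hg hts hpos hi hd.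
set (D := deriv_num a b f g).
set (G1 := laplace a b (fun t => - (t * g t))).
assert (G1neg : forall x, G1 x < 0).
{ intros x; apply laplace_mult_id_neg; auto; lra. }
assert (HD : forall x, D x = Haux F G x * G1 x).
{ intros x; unfold F, G; rewrite Haux_laplace by (auto; lra); fold G1 D.
  field; specialize (G1neg x); lra. }
assert (peak : forall x z, z <> x -> (z - x) * D x <= 0 -> Q z < Q x).
{ intros x z hz h.
  assert (p := laplace_ratio_peak a b ts f g x (z - x) hf hg hts hpos hi hd ltac:(lra) h).
  replace (x + (z - x)) with z in p by ring; exact p. }
assert (decr : forall x z, D x <= 0 -> x < z -> Q z < Q x).
{ intros x z h hxz; apply peak; [lra|nra]. }
assert (incr : forall x z, 0 <= D z -> x < z -> Q x < Q z).
{ intros x z h hxz; apply peak; [lra|nra]. }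
(* [D z > 0] would give [Q x < Q z] seen from [z], against [Q z < Q x] seen from [x]. *)
assert (upclosed : forall x z, D x <= 0 -> x < z -> D z <= 0).
{ intros x z h hxz; apply Rnot_lt_le; intros hz.
  assert (h1 := decr x z h hxz); assert (h2 := incr x z ltac:(lra) hxz); lra. }
(* By continuity [Haux] stays negative just to the right of 0, and multiplying by [G1 < 0] makes [D]
   positive. *)
assert (neg0 : Haux F G 0 < 0 -> exists x1, 0 < x1 /\ 0 < D x1).
{ intros hH.
  destruct (filterlim_Haux a b f g ha ltac:(lra) hf hg hpos _ (open_lt 0 _ hH)) as [d h].
  exists (d / 2); destruct d as [d pd]; simpl in *.
  split; [lra|].
  assert (Haux F G (d / 2) < 0).
  { apply h; [|lra].
    unfold ball; simpl; unfold AbsRing_ball, abs, minus, plus, opp; simpl.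
    rewrite Rabs_pos_eq; lra. }
  rewrite HD; specialize (G1neg (d / 2)); nra. }
split; [split|].
- intros hdec; apply Rnot_lt_le; intros hH; destruct (neg0 hH) as [x1 [p1 h1]].
  assert (h2 := incr (x1 / 2) x1 ltac:(lra) ltac:(lra)).
  assert (h3 := hdec (x1 / 2) x1 ltac:(lra) ltac:(lra) ltac:(lra)). lra.
- intros hH x z hx hz [hxz| ->]; [|lra].
  apply Rlt_le, decr; [|exact hxz].
  (* The sign at 0 itself propagates to all positive points. *)
  apply (upclosed 0); [|exact hx].
  rewrite HD; specialize (G1neg 0); nra.
- intros hH; destruct (neg0 hH) as [x1 [p1 h1]].
  (* [Q] exceeds its limit at some point. Were [D] positive far enough to the right, [Q] would there
     exceed that value, against convergence. *)
  assert (ex : exists x2, D x2 <= 0).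
  { assert (ga := hpos a ltac:(lra)).
    destruct (laplace_ratio_eventually_gt a b ts (f a / g a) f g) as [X hX]; auto; try lra.
    - intros; apply hpos; lra.
    - intros t ht; assert (gt := hpos t ltac:(lra)).
      apply Rlt_div_r; [lra|]; apply hi; lra.
    - set (x2 := Rmax X 0 + 1).
      assert (X <= Rmax X 0) by apply Rmax_l.
      specialize (hX x2 ltac:(unfold x2; lra)); fold F G in hX; fold (Q x2) in hX.
      assert (lim := is_lim_laplace_ratio a b f g hf hg ltac:(lra) hpos).
      apply is_lim_spec in lim; simpl in lim.
      (* The tolerance is the gap [Q x2 - f a / g a], which forces [Q x < Q x2] beyond [Y]. *)
      destruct (lim (mkposreal _ (proj2 (Rlt_0_minus _ _) hX))) as [Y hY]; simpl in hY.
      set (x3 := Rmax Y x2 + 1).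
      assert (Y <= Rmax Y x2) by apply Rmax_l.
      assert (x2 <= Rmax Y x2) by apply Rmax_r.
      exists x3; apply Rnot_lt_le; intros h3.
      assert (h4 := incr x2 x3 ltac:(lra) ltac:(unfold x3; lra)).
      specialize (hY x3 ltac:(unfold x3; lra)); fold F G in hY; fold (Q x3) in hY.
      apply Rabs_lt_between in hY; lra. }
  destruct ex as [x2 h2].
  (* The turning point is the supremum of the set where [D > 0]. *)
  destruct (completeness (fun x => 0 < D x)) as [xs [ub lub]].
  { exists x2; intros x hx; apply Rnot_lt_le; intros hlt.
    assert (h3 := upclosed x2 x h2 hlt); lra. }
  { now exists x1. }
  exists xs; split; [|split].
  + specialize (ub x1 h1); lra.
  + intros x z hx hz [hxz| ->]; [|lra].
    apply Rlt_le, incr; [|exact hxz].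
    apply Rnot_lt_le; intros hDz.
    (* If [D z <= 0], upward closure makes [z] an upper bound of that set. *)
    assert (xs <= z); [|lra].
    apply lub; intros u hu; apply Rnot_lt_le; intros hzu.
    assert (h3 := upclosed z u ltac:(lra) hzu); lra.
  + intros x z hx hz [hxz| ->]; [|lra].
    apply Rlt_le, decr; [|exact hxz].
    apply Rnot_lt_le; intros hDx; specialize (ub x hDx); lra.
Qed.

(** * Continuous extension from the interval to the line *)

(** The projection of the line onto [[a, b]], written with absolute values so that [reg] proves its
    continuity. *)
Definition clamp (a b t : R) : R := (a + b + Rabs (t - a) - Rabs (t - b)) / 2.

Lemma clamp_id (a b t : R) : a <= t <= b -> clamp a b t = t.
Proof.
intros ht; unfold clamp.
rewrite (Rabs_pos_eq (t - a)), (Rabs_left1 (t - b)) by lra; field.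
Qed.

Lemma clamp_bounds (a b t : R) : a <= b -> a <= clamp a b t <= b.
Proof.
intros hab; unfold clamp.
destruct (Rle_lt_dec a t); destruct (Rle_lt_dec t b);
  rewrite ?(Rabs_pos_eq (t - a)), ?(Rabs_left1 (t - a)),
    ?(Rabs_pos_eq (t - b)), ?(Rabs_left1 (t - b)) by lra; lra.
Qed.

(** [continuous_on] controls [f] only along the interval, which [clamp] never leaves. *)
Lemma continuity_clamp_comp (a b : R) (f : R -> R) :
  a <= b -> continuous_on (fun t => a <= t <= b) f -> continuity (fun t => f (clamp a b t)).
Proof.
intros hab hf t; apply continuity_pt_filterlim.
apply filterlim_comp with (2 := hf (clamp a b t) (clamp_bounds a b t hab)).
assert (cc : continuity (clamp a b)).
{ unfold clamp; reg. }
intros P hP; assert (h := continuity_continuous _ t cc _ hP).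
apply (filter_imp (F := locally t)) with (2 := h).
intros u hu; apply hu, clamp_bounds, hab.
Qed.

(** * Change of sign, and the two cases of the theorem *)

Lemma Haux_laplace_opp (a b : R) (f g : R -> R) (x : R) :
  0 < a -> a < b -> continuity f -> continuity g -> (forall t, a <= t <= b -> 0 < g t) ->
  Haux (laplace a b (fun t => - f t)) (laplace a b g) x = - Haux (laplace a b f) (laplace a b g) x.
Proof.
intros ha hab hf hg hpos; unfold Haux.
rewrite (Derive_ext _ _ _ (fun t => laplace_opp a b f t hf)), Derive_opp, laplace_opp
  by assumption.
unfold Rdiv; ring.
Qed.

Theorem theorem2 (a b : R) (f g : R -> R)
    (ha : 0 < a) (hab : a < b)
    (hf : continuous_on (fun t => a <= t <= b) f)
    (hg : continuous_on (fun t => a <= t <= b) g)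
    (hgpos : forall t, a <= t <= b -> 0 < g t) :
  let F := laplace a b f in
  let G := laplace a b g in
  let r := fun t => f t / g t in
  let Q := fun x => F x / G x in
  exists H0 : R,
    filterlim (Haux F G) (at_right 0) (locally H0) /\
    ((exists ts, a < ts < b /\
        strictly_increasing_on (fun t => a <= t <= ts) r /\
        strictly_decreasing_on (fun t => ts <= t <= b) r) ->
      (decreasing_on (fun x => 0 < x) Q <-> 0 <= H0) /\
      filterlim Q (at_right 0) (locally (RInt f a b / RInt g a b)) /\
      is_lim Q p_infty (f a / g a) /\
      (H0 < 0 ->
        exists xs, 0 < xs /\
          increasing_on (fun x => 0 < x < xs) Q /\
          decreasing_on (fun x => xs < x) Q)) /\
    ((exists ts, a < ts < b /\
        strictly_decreasing_on (fun t => a <= t <= ts) r /\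
        strictly_increasing_on (fun t => ts <= t <= b) r) ->
      (increasing_on (fun x => 0 < x) Q <-> H0 <= 0) /\
      filterlim Q (at_right 0) (locally (RInt f a b / RInt g a b)) /\
      is_lim Q p_infty (f a / g a) /\
      (0 < H0 ->
        exists xs, 0 < xs /\
          decreasing_on (fun x => 0 < x < xs) Q /\
          increasing_on (fun x => xs < x) Q)).
Proof.
intros F G r Q.
set (fc := fun t => f (clamp a b t)); set (gc := fun t => g (clamp a b t)).
assert (hfc : continuity fc) by (apply continuity_clamp_comp; [lra|exact hf]).
assert (hgc : continuity gc) by (apply continuity_clamp_comp; [lra|exact hg]).
assert (ef : forall t, a <= t <= b -> f t = fc t).
{ intros t ht; unfold fc; now rewrite clamp_id. }
assert (eg : forall t, a <= t <= b -> g t = gc t).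
{ intros t ht; unfold gc; now rewrite clamp_id. }
assert (er : forall t, a <= t <= b -> r t = fc t / gc t).
{ intros t ht; unfold r; now rewrite ef, eg. }
assert (hgcpos : forall t, a <= t <= b -> 0 < gc t).
{ intros t ht; rewrite <- eg; auto. }
(* Equality as functions allows rewriting under [Derive] in [Haux]. *)
assert (EF : F = laplace a b fc).
{ apply functional_extensionality; intros x; apply laplace_ext; auto; lra. }
assert (EG : G = laplace a b gc).
{ apply functional_extensionality; intros x; apply laplace_ext; auto; lra. }
assert (lim0 : filterlim Q (at_right 0) (locally (RInt f a b / RInt g a b))).
{ unfold Q; rewrite EF, EG, (RInt_ext_le f fc), (RInt_ext_le g gc) by (auto; lra).
  now apply laplace_ratio_lim_0. }
assert (limoo : is_lim Q p_infty (f a / g a)).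
{ unfold Q; rewrite EF, EG, ef, eg by lra; now apply is_lim_laplace_ratio. }
(* By continuity the one-sided limit is the value at 0. *)
exists (Haux F G 0); split; [|split].
- rewrite EF, EG; now apply filterlim_Haux.
- intros [ts [hts [hi hd]]].
  destruct (laplace_ratio_unimodal a b ts fc gc) as [h1 h2]; auto.
  { intros x y hx hy hxy; rewrite <- !er by lra; now apply hi. }
  { intros x y hx hy hxy; rewrite <- !er by lra; now apply hd. }
  rewrite <- EF, <- EG in h1, h2; auto.
- intros [ts [hts [hd hi]]].
  assert (ero : forall t, a <= t <= b -> - fc t / gc t = - r t).
  { intros t ht; rewrite er by exact ht; apply Rdiv_opp_l. }
  (* Negating [f] turns the valley of [r] into a peak and flips the signs of [Q] and [Haux]. *)
  destruct (laplace_ratio_unimodal a b ts (fun t => - fc t) gc) as [h1 h2]; auto.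
  { reg. }
  { intros x y hx hy hxy; rewrite !ero by lra; now apply Ropp_lt_contravar, hd. }
  { intros x y hx hy hxy; rewrite !ero by lra; now apply Ropp_lt_contravar, hi. }
  rewrite Haux_laplace_opp, <- EF, <- EG in h1, h2 by assumption.
  assert (EQ : forall x, laplace a b (fun t => - fc t) x / G x = - Q x).
  { intros x; rewrite laplace_opp, <- EF by assumption; apply Rdiv_opp_l. }
  assert (flip_inc : forall S, increasing_on S (fun x => laplace a b (fun t => - fc t) x / G x) ->
    decreasing_on S Q).
  { intros S h x y hx hy hxy; specialize (h x y hx hy hxy); cbn beta in h.
    rewrite !EQ in h; lra. }
  assert (flip_dec : forall S, decreasing_on S (fun x => laplace a b (fun t => - fc t) x / G x) <->
    increasing_on S Q).
  { intros S; split; intros h x y hx hy hxy; specialize (h x y hx hy hxy); cbn beta in *;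
      rewrite !EQ in *; lra. }
  split; [|split; [exact lim0|split; [exact limoo|]]].
  + rewrite <- flip_dec, h1; lra.
  + intros hH; destruct (h2 ltac:(lra)) as [xs [p [i d]]].
    exists xs; split; [exact p|split; [now apply flip_inc|now apply flip_dec]].
Qed.
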